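(* For every real $\epsilon>0$ and every positive integer $n$ with $n\geq \frac{384}{\epsilon^2}$, $$(3+\sqrt{3})n-8< R(F_n)\leq (5+\epsilon)n.$$
   Context: For a positive integer $n$, the $n$-fan $F_n$ is the graph on $2n+1$ vertices consisting of $n$ triangles that all share one common vertex and are otherwise vertex-disjoint (i.e. a vertex joined to all vertices of a matching with $n$ edges). For a graph $H$, the Ramsey number $R(H)$ is the smallest $N$ such that every coloring of the edges of $K_N$ with two colors contains a monochromatic copy of $H$ (as a not necessarily induced subgraph). *)

(* Defs.v *)
From mathcomp Require Import all_boot.

Set Implicit Arguments.
Unset Strict Implicit.
Unset Printing Implicit Defensive.

Record sgraph := SGraph {
  vertex :> finType;
  adj : rel vertex;
  adj_sym : symmetric adj;
  adj_irrefl : irreflexive adj }.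

(* A 2-colouring of the edges of K_N is a map c : {set 'I_N} -> bool of which
   only the values on two-element sets [set u; v], u != v, are ever used. *)
Definition colouring (N : nat) := {ffun {set 'I_N} -> bool}.

Definition mono_copy (H : sgraph) (N : nat) (c : colouring N) : bool :=
  [exists col : bool, exists f : {ffun H -> 'I_N},
    injectiveb f &&
    [forall x, forall y, adj x y ==> (c [set f x; f y] == col)]].

Definition arrows (H : sgraph) (N : nat) : bool :=
  [forall c : colouring N, mono_copy H c].

Lemma ramsey_clique (T : finType) (c : {set T} -> bool) (a b : nat)
    (A : {set T}) :
  2 ^ (a + b) <= #|A| ->
  exists col : bool, exists2 S : {set T},
    #|S| = (if col then a else b) &
    S \subset A /\ {in S &, forall x y, x != y -> c [set x; y] = col}.
Proof.
move Dn: (a + b) => n; elim: n a b Dn A => [|n IHn] [|a] [|b] //= ab A hA.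
- by exists true, set0; rewrite ?cards0 // sub0set; split=> // x y; rewrite inE.
- by exists true, set0; rewrite ?cards0 // sub0set; split=> // x y; rewrite inE.
- by exists false, set0; rewrite ?cards0 // sub0set; split=> // x y; rewrite inE.
have /card_gt0P[x xA] : 0 < #|A| by apply: leq_trans hA; rewrite expn_gt0.
pose B (col : bool) := [set y in A :\ x | c [set x; y] == col].
have cardB : #|A| = (#|B true| + #|B false|).+1.
  rewrite (cardsD1 x) xA add1n -(cardsID [set y | c [set x; y]]).
  by congr (_ + _).+1; apply: eq_card => y; rewrite !inE ?eqb_id ?eqbF_neg // andbC.
have extend (col : bool) (S : {set T}) k : S \subset B col -> #|S| = k ->
    {in S &, forall y z, y != z -> c [set y; z] = col} ->
    [/\ #|x |: S| = k.+1, x |: S \subset A &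
        {in x |: S &, forall y z, y != z -> c [set y; z] = col}].
  move=> SB cS mS; have xS : x \notin S.
    by apply/negP => /(subsetP SB); rewrite !inE eqxx.
  split; first by rewrite cardsU1 xS cS.
    apply/subsetP => y; rewrite !inE => /orP[/eqP-> //|/(subsetP SB)].
    by rewrite !inE => /andP[/andP[]].
  have mx y : y \in S -> c [set x; y] = col.
    by move=> /(subsetP SB); rewrite !inE => /andP[_ /eqP].
  move=> y z /setU1P[->|yS] /setU1P[->|zS]; first by rewrite eqxx.
  - by move=> _; apply: mx.
  - by move=> _; rewrite setUC; apply: mx.
  - exact: mS.
have weaken (col : bool) (S : {set T}) : S \subset B col -> S \subset A.
  by move=> /subset_trans; apply; apply/subsetP => y; rewrite !inE => /andP[/andP[]].
have [hT|hT] := leqP (2 ^ n) #|B true|.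
  have ab' : a + b.+1 = n by move: ab; rewrite addSn => -[].
  have [[] [S cS [SB mS]]] := IHn a b.+1 ab' _ hT.
    by have [cS' SA mS'] := extend true S a SB cS mS; exists true, (x |: S).
  by exists false, S => //; split=> //; apply: weaken SB.
have hF : 2 ^ n <= #|B false|.
  move: hA; rewrite cardB expnS mul2n -addnn.
  by move=> h; rewrite -(leq_add2l (2 ^ n)); apply: leq_trans h _; rewrite -addSn leq_add2r.
have ab' : a.+1 + b = n by move: ab; rewrite addnS => -[].
have [[] [S cS [SB mS]]] := IHn a.+1 b ab' _ hF.
  by exists true, S => //; split=> //; apply: weaken SB.
by have [cS' SA mS'] := extend false S b SB cS mS; exists false, (x |: S).
Qed.

Lemma ramsey_exists (H : sgraph) : exists N, arrows H N.
Proof.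
exists (2 ^ (#|H| + #|H|)); apply/forallP => c.
have [|col [S cS [_ mS]]] := @ramsey_clique _ c #|H| #|H| [set: _].
  by rewrite cardsT card_ord.
have {}cS : #|H| = #|S| by rewrite cS; case: col {cS mS}.
pose g (x : H) := enum_val (cast_ord cS (enum_rank x)).
have g_inj : injective g.
  by move=> x y /enum_val_inj /cast_ord_inj /enum_rank_inj.
apply/existsP; exists col; apply/existsP; exists (finfun g).
apply/andP; split; first by apply/injectiveP => x y; rewrite !ffunE => /g_inj.
apply/forallP => x; apply/forallP => y; apply/implyP => xy.
rewrite !ffunE mS ?enum_valP // (inj_eq g_inj).
by apply: contraTneq xy => ->; rewrite adj_irrefl.
Qed.

Definition ramsey_number (H : sgraph) : nat := ex_minn (ramsey_exists H).

(* None is the centre; Some (i, false) and Some (i, true) are the two other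
   vertices of the i-th triangle. *)
Definition fan_adj (n : nat) : rel (option ('I_n * bool)) :=
  fun u v =>
    match u, v with
    | None, None => false
    | None, Some _ | Some _, None => true
    | Some (i, s), Some (j, t) => (i == j) && (s != t)
    end.

Lemma fan_adj_sym (n : nat) : symmetric (@fan_adj n).
Proof.
by move=> [[i s]|] [[j t]|] //=; rewrite eq_sym; congr (_ && _); rewrite eq_sym.
Qed.

Lemma fan_adj_irrefl (n : nat) : irreflexive (@fan_adj n).
Proof. by move=> [[i s]|] //=; rewrite !eqxx. Qed.

Definition fan (n : nat) : sgraph :=
  SGraph (@fan_adj_sym n) (@fan_adj_irrefl n).

(* Main.v *)
Require Import Defs.
From mathcomp Require Import all_boot all_order all_algebra.
From mathcomp Require Import reals.
From mathcomp Require Import zify ring lra.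

Set Implicit Arguments.
Unset Strict Implicit.
Unset Printing Implicit Defensive.

(* Lower bound.  Take red cliques L_0, L_1 of size l and one red clique split
   into halves K_0, K_1 of size k.  Between L_s and K_s the red edges form a
   nearly biregular graph with d red edges at each vertex of L_s; all other
   edges are blue.  For l ~ sqrt 3 n, k ~ (3 - sqrt 3) n / 2, d ~ (2 - sqrt 3) n
   all red degrees are below 2n, and the blue edges inside each blue
   neighbourhood are covered by fewer than n vertices.

   Upper bound.  Without a monochromatic fan, no neighbourhood N_b(v) contains n
   independent edges of colour b, so by Tutte-Berge N_b(v) = S + T where T has
   at least |S| + |N_b(v)| - 2n + 2 components, between which all edges have the
   other colour.  If p lies in a small component of T, then most of T lies in the
   other neighbourhood of p, whose barrier S_p must leave T connected; either T
   (minus S_p) lies in one component of the rest T_p of that neighbourhood, or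
   S_p contains all of T but one component.  Start with v of maximum degree.  If
   the first case holds for all p in small components of T, then the components
   of T_p missing T provide a clique, joined in colour b to all of T but S_p, of
   more than 2|S_p| vertices; disjoint cliques of this kind for various p lie in
   a common N_b(t) and contain n independent edges.  If the second case occurs at
   some u, the barrier of u is so large that only the first case occurs from u
   on; the same argument at u, started with a clique from the components of T,
   gives a contradiction. *)

(** * Matchings *)

Section Matching.
Variables (V : finType) (e : rel V).
Implicit Types (D S A : {set V}) (f g : {ffun V -> V}).

(* A matching is encoded as the involution that swaps the ends of its edges
   and fixes the uncovered vertices. *)
Definition matching D f :=
  [forall x, (f (f x) == x) && ((f x != x) ==> (x \in D) && e x (f x))].

Definition covered f := [set x | f x != x].

Definition matching_number D := \max_(f | matching D f) #|covered f|.

Lemma matchingP D f :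
  reflect (involutive f /\ forall x, f x != x -> x \in D /\ e x (f x))
          (matching D f).
Proof.
apply: (iffP forallP) => [h|[fK h] x].
  by split=> [x|x fx]; move/andP: (h x) => [/eqP // _ /implyP/(_ fx)/andP].
by rewrite fK eqxx; apply/implyP => /h[-> ->].
Qed.

(** Each edge is counted at its end of smaller rank. *)
Lemma even_covered f : involutive f ->
  #|covered f| = (#|[set x | enum_rank x < enum_rank (f x)]|).*2.
Proof.
move=> fK; set B := [set x | _]; have f_inj := inv_inj fK.
have fB x : (x \in f @: B) = (enum_rank (f x) < enum_rank x).
  by rewrite -[in LHS](fK x) mem_imset // inE fK.
have -> : covered f = B :|: f @: B.
  apply/setP => x; rewrite in_setU fB !inE -neq_ltn (inj_eq val_inj).
  by rewrite (inj_eq enum_rank_inj) eq_sym.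
rewrite cardsU (_ : B :&: _ = set0) ?cards0 ?subn0 ?card_imset ?addnn //.
by apply/setP => x; rewrite in_setI fB !inE; case: ltngtP.
Qed.

Lemma matching_number_max D f : matching D f -> #|covered f| <= matching_number D.
Proof. exact: (@leq_bigmax_cond _ (matching D) (fun f => #|covered f|)). Qed.

Lemma matching_empty D : matching D (finfun id).
Proof. by apply/matchingP; split=> x; rewrite !ffunE ?eqxx. Qed.

Lemma matching_number_ex D :
  exists2 f, matching D f & #|covered f| = matching_number D.
Proof.
have [|f fM fmax] := @eq_bigmax_cond _ (matching D) (fun f => #|covered f|).
  by apply/card_gt0P; exists (finfun id); apply: matching_empty.
by exists f.
Qed.

Lemma even_matching_number D : ~~ odd (matching_number D).
Proof.
have [f /matchingP[fK _] <-] := matching_number_ex D.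
by rewrite even_covered // odd_double.
Qed.

Lemma matching_sub D S f : D \subset S -> matching D f -> matching S f.
Proof.
move=> /subsetP DS /matchingP[fK h]; apply/matchingP; split=> // x /h[xD ?].
by rewrite DS.
Qed.

Hypothesis e_sym : symmetric e.

(* Replaces the edge {y, f y} (if any) by {x, y}, where x is uncovered. *)
Definition rematch f x y : {ffun V -> V} :=
  [ffun w => if w == x then y else if w == y then x else
             if w == f y then w else f w].

Lemma rematchM D f x y : matching D f -> x \in D -> y \in D -> e x y ->
  x != y -> f x = x -> matching D (rematch f x y).
Proof.
move=> /matchingP[fK h] xD yD exy xy fx; have f_inj := inv_inj fK.
have yx : (y == x) = false by rewrite eq_sym (negbTE xy).
have fyx : (x == f y) = false by rewrite -{1}fx (inj_eq f_inj) (negbTE xy).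
apply/matchingP; split=> w; rewrite !ffunE.
  case: (eqVneq w x) => [->|wx]; first by rewrite yx eqxx.
  case: (eqVneq w y) => [->|wy]; first by rewrite eqxx.
  case: (eqVneq w (f y)) => [wfy|wfy]; first by rewrite (negbTE wx) (negbTE wy) wfy eqxx.
  have fwx : (f w == x) = false by rewrite -{1}fx (inj_eq f_inj) (negbTE wx).
  have fwy : (f w == y) = false by apply/negbTE; apply: contra wfy => /eqP<-; rewrite fK.
  by rewrite fwx fwy (inj_eq f_inj) (negbTE wy) fK.
case: (eqVneq w x) => [-> _|wx] //; case: (eqVneq w y) => [-> _|wy].
  by rewrite e_sym.
by case: (eqVneq w (f y)) => [->|wfy]; rewrite ?eqxx // => /h.
Qed.

Lemma covered_rematch f x y : involutive f -> x != y -> f x = x ->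
  covered (rematch f x y) = x |: (y |: (covered f :\ f y)).
Proof.
move=> fK xy fx; have f_inj := inv_inj fK.
apply/setP => w; rewrite !inE !ffunE.
case: (eqVneq w x) => [->|wx] /=; first by rewrite eq_sym xy.
case: (eqVneq w y) => [->|wy] /=; first by rewrite xy.
by case: (eqVneq w (f y)) => [->|wfy]; rewrite ?eqxx.
Qed.

Lemma card_covered_rematch f x y : involutive f -> x != y -> f x = x ->
  #|covered (rematch f x y)| = #|covered f| + (f y == y).*2.
Proof.
move=> fK xy fx; have f_inj := inv_inj fK; rewrite covered_rematch //.
have xN : x \notin y |: (covered f :\ f y).
  by rewrite !inE (negbTE xy) fx eqxx andbF.
have yN : (y \notin covered f :\ f y) = (f y == y).
  by rewrite !inE eq_sym andbb negbK.
have fyE : (f y \in covered f) = (f y != y) by rewrite inE fK eq_sym.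
have := cardsD1 (f y) (covered f).
by rewrite fyE !cardsU1 xN yN => ->; case: (f y == y) => /=; lia.
Qed.

Definition agreement f g := [set x | (f x != x) && (g x == f x)].

Definition inessential D x :=
  exists2 f, matching D f /\ #|covered f| = matching_number D & f x = x.

(** The disjunct [x = y] gives reflexivity. On inessential vertices this is an equivalence, whose
    classes become the components in [tutte_berge]. *)
Definition never_both_missed D x y := x = y \/
  forall f, matching D f -> #|covered f| = matching_number D ->
    f x = x -> f y = y -> False.

Lemma adjacent_never_both_missed D x y : x \in D -> y \in D -> e x y ->
  never_both_missed D x y.
Proof.
move=> xD yD exy; have [->|xy] := eqVneq x y; [by left | right] => f fM fmax fx fy.
have /matching_number_max := rematchM fM xD yD exy xy fx.
rewrite card_covered_rematch //; last by case/matchingP: fM.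
by rewrite fmax fy eqxx; lia.
Qed.

Lemma never_both_missed_sym D x y : never_both_missed D x y -> never_both_missed D y x.
Proof. by case=> [->|h]; [left | right=> f fM fmax fy fx; apply: (h f)]. Qed.

(* Gallai's lemma: with f missing x and z and g missing y of maximal agreement
   with f, an edge of f at a vertex missed by g can be moved into g. *)
Lemma never_both_missed_trans D x y z : inessential D y ->
  never_both_missed D x y -> never_both_missed D y z -> never_both_missed D x z.
Proof.
move=> [g0 [g0M g0max] g0y] [-> //|hxy] [<-|hyz]; first by right.
have [->|xz] := eqVneq x z; [by left | right] => f fM fmax fx fz.
pose P g := [&& matching D g, #|covered g| == matching_number D & g y == y].
have Pg0 : P g0 by rewrite /P g0M g0max g0y !eqxx.
case: (@arg_maxnP _ g0 P (fun g => #|agreement f g|) Pg0) => g.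
move=> /and3P[gM /eqP gmax /eqP gy] gbest.
have [fK fE] := matchingP _ _ fM; have [gK gE] := matchingP _ _ gM.
have gx : g x != x by apply/eqP => gx; apply: (hxy g).
have gz : g z != z by apply/eqP => gz; apply: (hyz g).
have fy : f y != y by apply/eqP => fy; apply: (hxy f).
(* [f] and [g] cover equally many vertices, and [g] but not [f] covers [x] and [z]; so at least two
   vertices are covered by [f] alone, one of them other than [y]. *)
have [w] : exists w, w \in (covered f :\: covered g) :\ y.
  apply/card_gt0P; have := cardsD1 y (covered f :\: covered g).
  rewrite !inE fy gy eqxx /=.
  have sub : [set x; z] \subset covered g :\: covered f.
    by apply/subsetP => w; rewrite !inE => /orP[]/eqP->; rewrite ?fx ?fz eqxx.
  have := subset_leq_card sub; rewrite cards2 xz.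
  have := cardsID (covered g) (covered f); have := cardsID (covered f) (covered g).
  by rewrite setIC fmax gmax; lia.
rewrite !inE negbK => /and3P[wy /eqP gw fw].
have [wD ew] := fE _ fw.
have fwD : f w \in D by apply: (fE (f w) _).1; rewrite fK eq_sym.
have wfw : w != f w by rewrite eq_sym.
pose g' := rematch g w (f w).
have g'M : matching D g' by apply: rematchM.
have cg' := card_covered_rematch gK wfw gw; rewrite -/g' in cg'.
have gfw : g (f w) != f w.
  apply/negP => gfw; have := matching_number_max g'M; rewrite cg' gfw gmax.
  by rewrite addnC [_ + _]/= ltnNge leqnSn.
rewrite (negbTE gfw) addn0 gmax in cg'.
have fwy : f w != y by apply: contraNneq gfw => ->; rewrite gy.
have Pg' : P g'.
  rewrite /P g'M cg' eqxx !ffunE (eq_sym y w) (eq_sym y (f w)) (negbTE wy) (negbTE fwy) /=.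
  by rewrite gy; case: ifP => _; rewrite eqxx.
have := gbest _ Pg'; apply/negP; rewrite -ltnNge; apply: proper_card.
apply/properP; split.
  apply/subsetP => v; rewrite !inE !ffunE => /andP[fv /eqP gfv]; rewrite fv /=.
  case: (eqVneq v w) => [->|vw] //; case: (eqVneq v (f w)) => [->|vfw].
    by rewrite fK.
  case: (eqVneq v (g (f w))) => [vE|_]; last by apply/eqP.
  by move: gfv; rewrite vE gK => /esym; rewrite -vE => /(inv_inj fK)/eqP; rewrite (negbTE vw).
exists w; first by rewrite inE fw /= ffunE !eqxx.
by rewrite inE gw [w == _]eq_sym andNb.
Qed.

(* Tutte-Berge, with k labelling the components outside S. *)
Theorem tutte_berge D : exists S (k : V -> {set V}),
  [/\ S \subset D,
      {in D :\: S &, forall x y, e x y -> k x = k y} &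
      forall Q : {set {set V}},
        #|S|.*2 + #|[set x in D :\: S | k x \in Q]| <= matching_number D + #|Q|].
Proof.
have [n] := ubnP #|D|; elim: n D => // n IHn D; rewrite ltnS => Dn.
have [/existsP[x /andP[xD /forallP xess]]|] := boolP [exists x in D, [forall f,
    matching D f && (#|covered f| == matching_number D) ==> (f x != x)]].
  have [|S [k [SD kE kQ]]] := IHn (D :\ x); first by move: Dn; rewrite (cardsD1 x) xD; lia.
  have DS : D :\: (x |: S) = (D :\ x) :\: S.
    by apply/setP => w; rewrite !inE negb_or; case: (w == x); rewrite /= ?andbF.
  have xS : x \notin S by apply/negP => /(subsetP SD); rewrite !inE eqxx.
  (* Every maximum matching covers [x], so deleting [x] lowers the number of covered vertices, by
     parity by at least 2: this pays for [x] in [#|S|.*2]. *)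
  have mu_lt : matching_number (D :\ x) + 2 <= matching_number D.
    have [f fM fmax] := matching_number_ex (D :\ x).
    have fM' : matching D f by apply: matching_sub fM; apply: subD1set.
    have fx : f x = x.
      by apply/eqP; apply: contraT => /(proj2 (matchingP _ _ fM))[]; rewrite !inE eqxx.
    have := xess f; rewrite fM' fx eqxx implybF /= => fnmax.
    have := matching_number_max fM'; move: fnmax; rewrite fmax.
    have := even_matching_number D; have := even_matching_number (D :\ x); lia.
  exists (x |: S), k; split; rewrite ?DS //.
    rewrite subUset sub1set xD /=; apply: subset_trans SD _; exact: subD1set.
  by move=> Q; have := kQ Q; rewrite cardsU1 xS; lia.
rewrite negb_exists => /forallP iness0.
have iness x : x \in D -> inessential D x.
  move=> xD; have := iness0 x; rewrite xD /= negb_forall => /existsP[f].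
  by rewrite negb_imply negbK => /andP[/andP[fM /eqP fmax] /eqP fx]; exists f.
pose r x y := (x == y) || [forall f, matching D f && (#|covered f| == matching_number D)
  && (f x == x) ==> (f y != y)].
have rP x y : reflect (never_both_missed D x y) (r x y).
  apply: (iffP orP) => [[/eqP|/forallP h]|[->|h]]; [by left | right | by left | right].
    move=> f fM fmax fx fy; have := h f; rewrite fM fmax fx fy !eqxx //.
  apply/forallP => f; apply/implyP => /andP[/andP[fM /eqP fmax] /eqP fx].
  by apply/eqP => fy; apply: (h f).
exists set0, (fun x => [set y in D | r x y]); split; first exact: sub0set.
  rewrite setD0 => x y xD yD /(adjacent_never_both_missed xD yD) xy.
  apply/setP => w; rewrite !inE; case wD: (w \in D) => //=.
  apply/rP/rP; first by move/never_both_missed_sym: xy; apply: never_both_missed_trans; apply: iness.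
  by apply: never_both_missed_trans => //; apply: iness.
move=> Q; rewrite cards0 setD0 double0 add0n; set X := [set x in D | _].
have [f fM fmax] := matching_number_ex D.
(* A maximum matching misses at most one vertex of each class. *)
rewrite -(cardsID (covered f) X) -fmax leq_add //.
  exact/subset_leq_card/subsetIr.
rewrite -(card_in_imset (f := fun x => [set y in D | r x y])).
  by apply/subset_leq_card/subsetP => _ /imsetP[x] + ->; rewrite !inE => /andP[_ /andP[]].
move=> x y; rewrite !inE !negbK => /andP[/eqP fx /andP[xD _]] /andP[/eqP fy /andP[yD _]].
move/setP/(_ y); rewrite !inE yD /= {2}/r eqxx /= => /rP[//|h].
by case: (h f).
Qed.

End Matching.

Section MatchingConstructions.
Variables (V : finType) (e : rel V).
Implicit Types (D K : {set V}) (f g : {ffun V -> V}).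

Lemma matching_on D f : matching e [set: V] f -> covered f \subset D -> matching e D f.
Proof.
move=> /matchingP[fK h] /subsetP fD; apply/matchingP; split=> // x fx.
by split; [apply: fD; rewrite inE | have [] := h x fx].
Qed.

Lemma matching_union f g : matching e [set: V] f -> matching e [set: V] g ->
  [disjoint covered f & covered g] ->
  exists2 h, matching e [set: V] h & covered h = covered f :|: covered g.
Proof.
move=> /matchingP[fK fE] /matchingP[gK gE] dis.
have fixg x : f x != x -> g x = x.
  move=> fx; apply/eqP/negPn; have := disjointFr dis (x := x).
  by rewrite !inE => ->.
exists [ffun x => if f x != x then f x else g x].
  apply/matchingP; split=> [x|x]; rewrite !ffunE; last first.
    by case: ifP => [fx _ | _ gx]; rewrite in_setT;
      split=> //; [have [] := fE x | have [] := gE x].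
  case: (boolP (f x == x)) => [/eqP fx|fx] /=; last by rewrite !fK eq_sym fx.
  case: (boolP (f (g x) == g x)) => [_|fg] /=; first exact: gK.
  have := fixg _ fg; rewrite gK => gx.
  by move: fg; rewrite -gx fx eqxx.
apply/setP => x; rewrite !inE ffunE; case: (boolP (f x == x)) => //= ->.
Qed.

(** Two vertices of a clique missed by a maximum matching could be joined, so at most one is
    missed. *)
Lemma clique_matching (K : {set V}) : symmetric e ->
  {in K &, forall x y, x != y -> e x y} ->
  exists2 f, matching e K f & (#|K|./2).*2 <= #|covered f|.
Proof.
move=> e_sym Kcl; have [f fM fmax] := matching_number_ex e K; exists f => //.
have fK : involutive f by case/matchingP: fM.
suff : #|K :\: covered f| <= 1.
  have := cardsID (covered f) K; have := subset_leq_card (subsetIr K (covered f)).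
  have := even_covered fK; lia.
rewrite leqNgt; apply/negP => /card_gt1P[x [y [xK yK xy]]].
move: xK yK; rewrite !inE !negbK => /andP[/eqP fx xK] /andP[/eqP fy yK].
by have [/eqP|h] := adjacent_never_both_missed e_sym xK yK (Kcl _ _ xK yK xy);
  [rewrite (negbTE xy) | apply: (h f)].
Qed.

End MatchingConstructions.

(** * Transversals of labelled vertex sets *)

Lemma transversal_ex (V : finType) (L : eqType) (k : V -> L) (X : {set V}) :
  exists2 R : {set V}, R \subset X & {in R &, injective k} /\
    forall x, x \in X -> exists2 y, y \in R & k y = k x.
Proof.
pose r x := odflt x [pick y in X | k y == k x].
have rP x : x \in X -> r x \in X /\ k (r x) = k x.
  rewrite /r; case: pickP => [y /andP[yX /eqP ->] //|/(_ x)].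
  by rewrite eqxx andbT => -> .
have rr x y : x \in X -> k x = k y -> r x = r y.
  move=> xX kxy; rewrite /r kxy.
  by case: pickP => // /(_ x); rewrite xX kxy eqxx.
exists (r @: X); first by apply/subsetP => _ /imsetP[x /rP[] ? _ ->].
split=> [_ _ /imsetP[x xX ->] /imsetP[y yX ->]|x xX].
  by rewrite (rP _ xX).2 (rP _ yX).2 => /(rr _ _ xX).
by exists (r x); [apply: imset_f | have [] := rP _ xX].
Qed.

Lemma card_transversal (V L : finType) (k : V -> L) (X R : {set V}) :
  {in R &, injective k} ->
  (forall x, x \in X -> exists2 y, y \in R & k y = k x) -> #|k @: X| <= #|R|.
Proof.
move=> kI h; rewrite -(card_in_imset kI); apply/subset_leq_card/subsetP.
by move=> _ /imsetP[x xX ->]; have [y yR <-] := h x xX; apply: imset_f.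
Qed.

(** [W] represents the classes with at most [K] elements; the others have at least [K.+1] each, so
    there are at most [#|T| / K.+1] of them. *)
Lemma small_transversal (V L : finType) (k : V -> L) (T : {set V}) (K : nat) :
  exists W : {set V}, [/\ W \subset T,
    {in W &, injective k},
    {in W, forall x, #|[set y in T | k y == k x]| <= K} &
    #|k @: T| * K.+1 <= #|W| * K.+1 + #|T|].
Proof.
pose X := [set x in T | #|[set y in T | k y == k x]| <= K].
have [W WX [kI hW]] := transversal_ex k X; exists W.
have XT : X \subset T by apply/subsetP => x; rewrite inE => /andP[].
split=> //; first exact: subset_trans WX XT.
  by move=> x /(subsetP WX); rewrite inE => /andP[].
have XW := card_transversal kI hW.
rewrite -(cardsID (k @: X)) mulnDl leq_add //.
  rewrite leq_mul2r; apply/orP; right; apply: leq_trans XW.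
  exact/subset_leq_card/subsetIr.
rewrite -[leqRHS]sum1_card (partition_big_imset k) /= -sum_nat_const.
rewrite [leqRHS](bigID (fun c => c \in k @: X)) /=.
apply: leq_trans (leq_addl _ _).
rewrite (eq_bigl (fun c => (c \in k @: T) && (c \notin k @: X))); last first.
  by move=> c; rewrite inE andbC.
apply: leq_sum => _ /andP[/imsetP[x xT ->]] xX.
rewrite sum1dep_card ltnNge; apply: contra xX => h.
by apply: imset_f; rewrite inE xT.
Qed.

(** * Barriers of monochromatic neighbourhoods *)

Section TwoColours.
Variables (V : finType) (col : rel V).
Hypothesis col_sym : symmetric col.
Implicit Types (S T X K : {set V}) (k : V -> {set V}).

Definition edge (b : bool) : rel V := fun x y => (x != y) && (col x y == b).

Definition nbhd (b : bool) (v : V) := [set x | edge b v x].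

Lemma edge_sym b : symmetric (edge b).
Proof. by move=> x y; rewrite /edge eq_sym col_sym. Qed.

Lemma edgeN b x y : edge b x y -> edge (~~ b) x y -> False.
Proof. by case/andP=> _ /eqP<- /andP[_ /eqP]; case: (col x y). Qed.

Lemma card_nbhd b v : #|nbhd b v| + #|nbhd (~~ b) v| = #|V|.-1.
Proof.
rewrite -(cardsC1 v) -(cardsID (nbhd b v) [set~ v]).
congr (_ + _); apply: eq_card => x; rewrite !inE /edge eq_sym.
  by case: (x == v); rewrite ?andbF.
by case: (x == v); rewrite ?andbF //=; case: b; case: (col v x).
Qed.

(* The barrier S and component labelling k that Tutte-Berge attaches to a
   neighbourhood without n independent edges. *)
Definition barrier (n : nat) b v S (k : V -> {set V}) :=
  [/\ S \subset nbhd b v,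
      {in nbhd b v :\: S &, forall x y, k x != k y -> edge (~~ b) x y} &
      forall Q : {set {set V}},
        #|S|.*2 + #|[set x in nbhd b v :\: S | k x \in Q]| <= n.-1.*2 + #|Q|].

(** Independent edges of colour [b] in the [b]-neighbourhood of [v] span triangles at [v], and [n]
    of them form a fan. *)
Definition fan_free n := forall b v f,
  matching (edge b) (nbhd b v) f -> #|covered f| < n.*2.

Lemma barrier_ex n b v : fan_free n -> exists S k, barrier n b v S k.
Proof.
move=> ff; have [S [k [SD kE kQ]]] := tutte_berge (@edge_sym b) (nbhd b v).
exists S, k; split=> // [x y xT yT kxy|Q].
  apply: contraNT kxy => xy; have [->//|xNy] := eqVneq x y.
  apply/eqP/kE => //; move: xy; rewrite /edge xNy /=.
  by case: b {SD kE kQ xT yT} (col x y) => [] [].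
apply: leq_trans (kQ Q) _; rewrite leq_add2r.
have [f fM <-] := matching_number_ex (edge b) (nbhd b v).
have := ff _ _ _ fM; have [fK _] := matchingP _ _ _ fM.
by rewrite even_covered // ltn_double leq_double; case: n {ff}.
Qed.

Section Barrier.
Variables (n : nat) (b : bool) (v : V) (S : {set V}) (k : V -> {set V}).
Hypothesis bar : barrier n b v S k.

Let T := nbhd b v :\: S.

Lemma barrier_card : #|S| + #|T| = #|nbhd b v|.
Proof.
case: bar => SD _ _; rewrite -(cardsID S (nbhd b v)); congr (_ + _).
by rewrite (setIidPr SD).
Qed.

Lemma barrier_classes : #|S|.*2 + #|T| <= n.-1.*2 + #|k @: T|.
Proof.
case: bar => _ _ /(_ (k @: T)); congr (_ + _ <= _); apply: eq_card => x.
by rewrite inE; case xT: (x \in T); rewrite //= imset_f.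
Qed.

Lemma barrier_class (X : {set V}) c : X \subset T -> {in X, forall x, k x = c} ->
  #|S|.*2 + #|X| <= n.-1.*2 + 1.
Proof.
move=> /subsetP XT Xc; case: bar => _ _ /(_ [set c]); rewrite cards1.
apply: leq_trans; rewrite leq_add2l; apply/subset_leq_card/subsetP => x xX.
by rewrite !inE Xc // eqxx andbT; have := XT x xX; rewrite !inE.
Qed.

Lemma barrier_size : #|S| <= n.-1.
Proof.
have h : {in set0, forall x, k x = set0} by move=> x; rewrite inE.
by have := barrier_class (sub0set _) h; rewrite cards0; lia.
Qed.

Lemma barrier_cross x y : x \in T -> y \in T -> k x != k y -> edge (~~ b) x y.
Proof. by case: bar => _ h _; apply: h. Qed.

(* One vertex from each component other than c. *)
Lemma barrier_clique c : exists K : {set V}, [/\ K \subset nbhd b v,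
  {in K &, forall x y, x != y -> edge (~~ b) x y},
  {in T & K, forall x y, k x = c -> edge (~~ b) x y} &
  #|k @: T| <= #|K|.+1].
Proof.
have [R RX [kI hR]] := transversal_ex k [set x in T | k x != c].
have RT x : x \in R -> x \in T /\ k x != c.
  by move/(subsetP RX); rewrite inE => /andP[].
exists R; split.
- by apply/subsetP => x /RT[]; rewrite inE => /andP[].
- move=> x y xR yR xy; apply: barrier_cross; try by case: (RT _ xR); case: (RT _ yR).
  by apply: contra xy => /eqP/kI->.
- by move=> x y xT /RT[yT yc] xc; apply: barrier_cross; rewrite // xc eq_sym.
apply: leq_trans (_ : #|c |: k @: [set x in T | k x != c]| <= _).
  apply/subset_leq_card/subsetP => _ /imsetP[x xT ->]; rewrite in_setU1.
  by case: eqVneq => //= kx; apply: imset_f; rewrite inE xT.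
rewrite cardsU1; have := card_transversal kI hR; lia.
Qed.

End Barrier.

Definition component (T : {set V}) (k : V -> {set V}) p := [set x in T | k x == k p].

(* What remains of T is connected in the colour b between different components
   of T, but only inside components for the barrier of p. *)
Lemma barrier_dichotomy n b v S k p S' k' : barrier n b v S k ->
  p \in nbhd b v :\: S -> barrier n (~~ b) p S' k' ->
  let T := nbhd b v :\: S in
  let X := T :\: (component T k p :|: S') in
  X \subset nbhd (~~ b) p :\: S' /\
  ((exists c, {in X, forall x, k' x = c}) \/
   (exists c, {in X, forall x, k x = c}) /\ #|k @: T| <= #|S'| + 2).
Proof.
move=> bar pT bar' T X.
have XT x : x \in X -> [/\ x \in T, k x != k p & x \notin S'].
  by rewrite in_setD in_setU inE => /andP[+ xT]; rewrite xT negb_or => /andP[].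
have XT' : X \subset nbhd (~~ b) p :\: S'.
  apply/subsetP => x /XT[xT kx xS']; rewrite !inE xS' /=.
  by apply: (barrier_cross bar); rewrite // eq_sym.
split=> //; have cross x y : x \in X -> y \in X -> k x != k y -> k' x = k' y.
  move=> xX yX kxy; apply/eqP; apply: contraT => kxy'; exfalso.
  have [xT _ _] := XT _ xX; have [yT _ _] := XT _ yX.
  apply: (edgeN (barrier_cross bar xT yT kxy)).
  by apply: (barrier_cross bar') => //; apply: (subsetP XT').
(* Vertices of [X] in different components of [T] share a [k']-component; so if [X] meets two
   components of [T], it lies in one [k']-component. *)
have [/existsP[x /existsP[y /and3P[xX yX kxy]]]|] :=
  boolP [exists x, exists y, [&& x \in X, y \in X & k x != k y]].
  left; exists (k' x) => z zX; have [kxz|kxz] := eqVneq (k x) (k z).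
    by rewrite (cross x y) //; apply: cross => //; rewrite -kxz.
  by apply: cross; rewrite // eq_sym.
rewrite negb_exists => /forallP same; right.
have {}same x y : x \in X -> y \in X -> k x = k y.
  move=> xX yX; have := same x; rewrite negb_exists => /forallP/(_ y).
  by rewrite xX yX /= negbK => /eqP.
have [c Xc] : exists c, {in X, forall x, k x = c}.
  case: (set_0Vmem X) => [X0|[x xX]]; last by exists (k x) => y yX; apply: same.
  by exists set0 => x; rewrite X0 inE.
split; first by exists c.
(* A component of [T] other than [k p] and [c] lies inside [S']. *)
apply: leq_trans (_ : #|[set k p; c] :|: k @: S'| <= _).
  apply/subset_leq_card/subsetP => _ /imsetP[x xT ->]; rewrite !inE.
  case: (eqVneq (k x) (k p)) => //= kx; case xS': (x \in S').
    by rewrite imset_f ?orbT.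
  have xX : x \in X by rewrite in_setD in_setU inE xT xS' orbF andbT kx.
  by rewrite (Xc x xX) eqxx.
apply: leq_trans (leq_card_setU _ _) _; rewrite addnC.
by apply: leq_add; [apply: leq_imset_card | rewrite cards2; case: eqP].
Qed.

End TwoColours.

(** * Greedy assembly of a large matching *)

Section Greedy.
Variables (V : finType) (col : rel V).
Hypothesis col_sym : symmetric col.
Implicit Types (S T X K M W F : {set V}) (k : V -> {set V}).
Notation edge := (edge col).
Notation nbhd := (nbhd col).
Notation barrier := (barrier col).
Notation fan_free := (fan_free col).

(* K is a clique of colour c attached to p in the other colour, and joined in
   colour c to everything in M outside F. *)
Definition gadget c M p F K := [/\ p \in F,
  {in K &, forall x y, x != y -> edge c x y}, K \subset nbhd (~~ c) p &
  {in M :\: F & K, forall t y, edge c t y}].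

(* Choose p_1, p_2, ... in W, each outside the sets F of its predecessors: the
   cliques K are then disjoint, since K_i is joined to p_j in colour c for i < j
   while K_j is joined to it in the other colour.  Any t in M outside all the F
   sees the union of the cliques in colour c. *)
Lemma greedy c M W n lam G h (B : Prop) : 0 < n -> W \subset M ->
  (forall p, p \in W -> B \/ exists F K,
     [/\ gadget c M p F K, n * #|F| <= lam * (#|K|./2) & #|F| <= h]) ->
  lam * G.-1 < n * #|W| -> lam * G.-1 + n * h < n * #|M| ->
  B \/ exists t f, [/\ t \in M, matching (edge c) [set: V] f,
    {in covered f, forall y, edge c t y},
    {in covered f, forall y, exists2 p, p \in W & edge (~~ c) p y} &
    G.*2 <= #|covered f|].
Proof.
move=> n0 WM hW cW cM.
(* [U] is the union of the sets [F] used so far; each edge found costs at most [lam / n] vertices of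
   [U]. *)
pose state (U : {set V}) (f : {ffun V -> V}) :=
  [/\ matching (edge c) [set: V] f, {in M :\: U & covered f, forall t y, edge c t y},
   {in covered f, forall y, exists2 p, p \in W & edge (~~ c) p y} &
   n * #|U| <= lam * (#|covered f|./2)].
have cov0 : covered (finfun (@id V)) = set0.
  by apply/setP => x; rewrite !inE ffunE eqxx.
have state0 : state set0 (finfun id).
  by rewrite /state cov0 cards0 muln0; split=> // [|t y _|y]; rewrite ?inE //; apply: matching_empty.
suff step m U f : state U f -> #|covered f|./2 < G -> G <= #|covered f|./2 + m ->
    B \/ exists t f, [/\ t \in M, matching (edge c) [set: V] f,
    {in covered f, forall y, edge c t y},
    {in covered f, forall y, exists2 p, p \in W & edge (~~ c) p y} &
    G.*2 <= #|covered f|].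
  have [G0|G0] := posnP G; last first.
    by apply: (step G _ _ state0); rewrite cov0 cards0 ?add0n.
  have [t tM] : exists t, t \in M.
    by apply/card_gt0P; rewrite -(ltn_pmul2l n0); apply: leq_ltn_trans cM; rewrite muln0.
  right; exists t, (finfun id); rewrite cov0 G0; split=> // [|y|y]; rewrite ?inE //.
  exact: matching_empty.
elim: m U f => [|m IHm] U f [fM fE fW Uc] fG Gm.
  by move: fG; rewrite ltnNge; case/negP; rewrite addn0 in Gm.
have fG1 : lam * (#|covered f|./2) <= lam * G.-1.
  by rewrite leq_mul2l -ltnS (ltn_predK fG) fG orbT.
have /subsetPn[p pW pU] : ~~ (W \subset U).
  apply: contraL cW => /subset_leq_card WU; rewrite -leqNgt.
  by apply: leq_trans (leq_trans Uc fG1); rewrite leq_mul2l WU orbT.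
have pM : p \in M :\: U by rewrite inE pU (subsetP WM).
have [|[F [K [[pF Kcl Kp FK] Fc Fh]]]] := hW p pW; first by left.
have [g gM gK] := clique_matching (edge_sym col_sym c) Kcl.
have gsub : covered g \subset K.
  by apply/subsetP => y; rewrite inE => /(matchingP _ _ _ gM).2[].
have gM' : matching (edge c) [set: V] g by apply: matching_sub gM; apply: subsetT.
have dis : [disjoint covered f & covered g].
  apply/pred0P => y /=; apply/negP => /andP[yf yg].
  have := subsetP Kp _ (subsetP gsub _ yg); rewrite inE.
  exact: edgeN (fE p y pM yf).
have [h' h'M h'c] := matching_union fM gM' dis.
have ch' : #|covered h'| = #|covered f| + #|covered g|.
  by rewrite h'c cardsU disjoint_setI0 // cards0 subn0.
have half : #|covered f|./2 + #|K|./2 <= #|covered h'|./2.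
  by rewrite ch'; move: gK; move: #|_| #|_| #|_| => x y z; clear; lia.
have K0 : 0 < #|K|./2.
  have F0 : 0 < #|F| by apply/card_gt0P; exists p.
  have : 0 < lam * (#|K|./2) by apply: leq_trans Fc; rewrite muln_gt0 n0.
  by rewrite muln_gt0 => /andP[].
have h'E : {in M :\: (U :|: F) & covered h', forall t y, edge c t y}.
  move=> t y; rewrite h'c in_setD in_setU in_setU negb_or => /andP[/andP[tU tF] tM].
  case/orP => [yf|yg]; first by apply: fE; rewrite // inE tU.
  by apply: FK; [rewrite inE tF | apply: (subsetP gsub)].
have h'W : {in covered h', forall y, exists2 p, p \in W & edge (~~ c) p y}.
  move=> y; rewrite h'c in_setU => /orP[/fW //|yg]; exists p => //.
  by have := subsetP Kp _ (subsetP gsub _ yg); rewrite inE.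
have Uf : n * #|U :|: F| <= n * #|U| + n * #|F|.
  by rewrite -mulnDr leq_mul2l leq_card_setU orbT.
have [small|big] := ltnP (#|covered h'|./2) G.
  apply: (IHm (U :|: F) h') => //; last first.
    apply: leq_trans Gm _; rewrite addnS -addSn leq_add2r.
    by apply: leq_trans half; rewrite -addn1 leq_add2l.
  split=> //; apply: leq_trans Uf _; apply: leq_trans (leq_add Uc Fc) _.
  by rewrite -mulnDr leq_mul2l half orbT.
have /subsetPn[t tM tU] : ~~ (M \subset U :|: F).
  apply: contraL cM => /subset_leq_card MU; rewrite -leqNgt.
  apply: leq_trans (_ : n * #|U :|: F| <= _); first by rewrite leq_mul2l MU orbT.
  apply: leq_trans Uf _; apply: leq_add; first exact: leq_trans Uc fG1.
  by rewrite leq_mul2l Fh orbT.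
right; exists t, h'; split=> //; first by move=> y; apply: h'E; rewrite inE tU.
by move: big; move: #|_| => x; clear; lia.
Qed.

(** For the gadget, [F] is the component of [p] together with [S']. The bound on [#|T|] holds as [T]
    outside [F] is in one [k']-component; that on [K], as [K] meets all the others. *)
Lemma gadget_or n b u S k p C M : fan_free n -> barrier n b u S k ->
  let T := nbhd b u :\: S in
  p \in T -> #|component T k p| <= C -> M \subset T ->
  exists S' k', barrier n (~~ b) p S' k' /\
  ((exists F K, [/\ gadget b M p F K, #|F| <= C + #|S'|,
      #|S'| + #|T| <= n.-1.*2.+1 + C &
      #|S'| + #|nbhd (~~ b) p| <= n.-1.*2.+1 + #|K|]) \/
   (exists c, {in T :\: (component T k p :|: S'), forall x, k x = c}) /\
   #|k @: T| <= #|S'| + 2).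
Proof.
move=> ff bar T pT pC MT; have [S' [k' bar']] := barrier_ex col_sym (~~ b) p ff.
exists S', k'; split=> //.
have [XT' [[c Xc]|]] := barrier_dichotomy bar pT bar'; last by right.
left; have [K [Kp Kcl Kc Kq]] := barrier_clique bar' c; rewrite !negbK in Kcl Kc.
have := barrier_card bar'; have := barrier_classes bar'.
have := barrier_class bar' XT' Xc; set X := T :\: _ in XT' Xc *.
have : #|component T k p :|: S'| <= #|component T k p| + #|S'| by rewrite leq_card_setU.
have : #|T| <= #|X| + #|component T k p :|: S'|.
  by rewrite -(cardsID (component T k p :|: S') T) addnC leq_add2l subset_leq_card ?subsetIr.
move=> h1 h2 h3 h4 h5.
exists (component T k p :|: S'), K; split=> //.
- split=> //; first by rewrite in_setU /component inE pT eqxx.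
  move=> t y; rewrite in_setD => /andP[tF tM] yK.
  have tX : t \in X by rewrite in_setD tF (subsetP MT).
  by apply: Kc; rewrite ?Xc // (subsetP XT').
- by apply: leq_trans h2 _; rewrite leq_add2r.
- by move: h1 h2 h3 pC; clear; lia.
by move: h4 h5 Kq; clear; lia.
Qed.

End Greedy.

(** * Upper bound *)

(** At most [t / C.+1] components have more than [C] vertices; the quadratic condition on [E] makes
    this at most [E / 2]. *)
Lemma few_large_components (n E C q w t : nat) : E < 3 * C.+1 -> 30 * n + 5 * E <= E * E ->
  t <= 5 * n + E -> q * C.+1 <= w * C.+1 + t -> 2 * q <= 2 * w + E.
Proof. nia. Qed.

(* With unprimed letters for the barrier of a vertex v of maximum degree d and
   primed ones for that of a neighbour u: s is the size of the barrier, t that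
   of the rest of the neighbourhood, q its number of components, w' the number
   of components of size at most C.  Further, m and w count M and the choices
   in M as in bad_splitN, and kv is the size of the clique found at v. *)
Section Arithmetic.
Variables (n E C d s t q s' d' t' q' w' m w kv : nat).
Hypotheses (n0 : 0 < n) (C2 : 2 <= C) (CE : 3 * C <= E).
Hypotheses (dE : 5 * n + E <= 2 * d + 1) (std : s + t = d) (stq : s.*2 + t <= n.-1.*2 + q).
Hypotheses (qs' : q <= s' + 2) (s'n : s' <= n.-1) (dd' : 5 * n + E <= d + 1 + d').
Hypotheses (std' : s' + t' = d') (stq' : s'.*2 + t' <= n.-1.*2 + q').
Hypotheses (qw' : 2 * q' <= 2 * w' + E) (tm : t <= m + C + s') (mt' : m <= t').
Hypotheses (ww' : w' + m <= w + t') (qkv : q <= kv + 1).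

(** [h] bounds [#|F|], and [B] is [h] in the worst case [s' = n - 1]. [G] counts the edges needed
    beside those in the clique at [v]. *)
Let B := d + 2 * C - (2 * n + E + 1).
Let G := n - kv./2.
Let h := d + 2 * C + s' - (3 * n + E).

(** By [stq] and [qs'], [s' >= d - 2 * n]; then [stq'] and [dd'] force [q' >= n + E + 1], beyond
    [s'' + 2 <= n + 1]. *)
Lemma arith_no_split s'' : s'' <= n.-1 -> q' <= s'' + 2 -> False.
Proof. lia. Qed.

Lemma arith_gadget s'' dp kp F : F <= C + s'' -> s'' + t' <= n.-1.*2.+1 + C ->
  5 * n + E <= d + 1 + dp -> s'' + dp <= n.-1.*2.+1 + kp ->
  n * F <= 2 * B * (kp./2) /\ F <= h.
Proof.
move=> h1 h2 h3 h4; split; last by rewrite /h; lia.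
have FB : C + s'' <= B by rewrite /B; lia.
have Bn : B <= n by rewrite /B; lia.
have kpB : C + s'' + (n - B) <= 2 * (kp./2) by rewrite /B in FB Bn *; lia.
(* With [y = C + s''], [n * y <= B * (y + n - B)] because [(n - B) * (B - y) >= 0]. *)
move: h1 FB Bn kpB; move: (kp./2) B (C + s'') => x B' y; clear; nia.
Qed.

Lemma arith_loss : 2 * B * G.-1 <= n * (n - s).
Proof.
have Y : 2 * G.-1 + q <= 2 * n by rewrite /G; lia.
have [BA An] : B <= d - 2 * n /\ d - 2 * n + s <= n by rewrite /B; lia.
have qA : s + (d - 2 * n) + 2 <= q by lia.
(* With [A = d - 2 * n], the left side is at most [A * (2 * n - s - A)], and
   [(n - A) * (n - s - A) >= 0]. *)
move: Y BA An qA; rewrite -mulnA mulnCA; move: G.-1 (d - 2 * n) B => g A B' Y BA An qA.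
by clear - Y BA An qA; nia.
Qed.

Lemma arith_choices : 2 * B * G.-1 < n * w.
Proof.
apply: leq_ltn_trans arith_loss _; rewrite ltn_pmul2l //; lia.
Qed.

Lemma arith_room : 2 * B * G.-1 + n * h < n * m.
Proof.
have := arith_loss; have : n - s + h < m by rewrite /h; lia.
move: (2 * B * G.-1) h => x y; clear -n0; nia.
Qed.

End Arithmetic.

Section MaximumDegree.
Variables (V : finType) (col : rel V).
Hypothesis col_sym : symmetric col.
Variables (n E C : nat).
Hypotheses (n0 : 0 < n) (C2 : 2 <= C) (CE : 3 * C <= E) (EC : E < 3 * C.+1).
Hypotheses (nE : 30 * n + 5 * E <= E * E) (cardV : #|V| = 5 * n + E).
Hypothesis ff : fan_free col n.
Implicit Types (S T X K M W F : {set V}) (k : V -> {set V}).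
Notation edge := (edge col).
Notation nbhd := (nbhd col).
Notation barrier := (barrier col n).

Variables (b : bool) (v : V) (S : {set V}) (k : V -> {set V}).
Hypothesis bar : barrier b v S k.
Hypothesis vmax : forall c p, #|nbhd c p| <= #|nbhd b v|.

Let T := nbhd b v :\: S.

(* Some u in a small component splits the rest T of the neighbourhood of v
   along a single component of T, so its barrier meets all the others. *)
Definition bad_split := exists u S' k' c,
  [/\ u \in T, #|component T k u| <= C, barrier (~~ b) u S' k',
      {in T :\: (component T k u :|: S'), forall x, k x = c} & #|k @: T| <= #|S'| + 2].

Lemma min_nbhd c p : 5 * n + E <= #|nbhd b v| + 1 + #|nbhd c p|.
Proof.
have := card_nbhd col c p; have := vmax (~~ c) p; rewrite cardV.
move: #|_| #|_| #|_| => x y z; lia.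
Qed.

Lemma max_nbhd : 5 * n + E <= 2 * #|nbhd b v| + 1.
Proof. by have := min_nbhd b v; lia. Qed.

Lemma bad_split_ex : bad_split.
Proof.
have [W [WT kI Wsmall Wq]] := small_transversal k T C.
have Tle : #|T| <= 5 * n + E by rewrite -cardV; apply: max_card.
have qw := few_large_components EC nE Tle Wq.
have := barrier_card bar; have := barrier_classes bar; have := barrier_size bar.
rewrite -/T => sn stq std; have dE := max_nbhd.
have w0 : 0 < #|W| by move: qw sn stq std dE n0; clear; lia.
have small p : p \in W -> bad_split \/ exists F K S' : {set V},
     [/\ gadget col b T p F K, #|F| <= C + #|S'|, #|S'| + #|T| <= n.-1.*2.+1 + C &
       #|S'| + #|nbhd (~~ b) p| <= n.-1.*2.+1 + #|K|].
  move=> pW; have pT := subsetP WT p pW.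
  have [S' [k' [bar' [[F [K [? ? ? ?]]]|[[c Xc] qS']]]]] :=
    gadget_or col_sym ff bar pT (Wsmall p pW) (subxx _).
    by right; exists F, K, S'.
  by left; exists p, S', k', c; split=> //; apply: Wsmall.
(* One gadget already bounds [#|T|], which keeps the subtraction in [h] below from truncating. *)
have [p0 p0W] := card_gt0P w0.
have [//|[F0 [K0 [S0 [_ _ s0t _]]]]] := small p0 p0W.
pose h := n.-1.*2.+1 + 2 * C - #|T|.
have gadgets p : p \in W -> bad_split \/ exists F K : {set V},
    [/\ gadget col b T p F K, n * #|F| <= n * (#|K|./2) & #|F| <= h].
  move=> pW; have [?|[F [K [S' [gad FS' St dK]]]]] := small p pW; [by left|right].
  have dp := min_nbhd (~~ b) p; exists F, K; split=> //.
    rewrite leq_pmul2l //.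
    by move: FS' St dK std stq sn dE s0t dp CE n0; clear; lia.
  by rewrite /h; move: FS' St; clear; lia.
have choices : n * n.-1 < n * #|W|.
  by rewrite ltn_pmul2l //; move: qw sn stq std dE n0 s0t CE; clear; lia.
have room : n * n.-1 + n * h < n * #|T|.
  rewrite -mulnDr ltn_pmul2l // /h.
  by move: qw sn stq std dE n0 s0t CE; clear; lia.
have [//|[t [f [tT fM fE _ fn]]]] := greedy col_sym n0 WT gadgets choices room.
exfalso; have fN : covered f \subset nbhd b t.
  by apply/subsetP => y /fE; rewrite inE.
by have := ff (matching_on fM fN); rewrite ltnNge fn.
Qed.

Lemma bad_splitN : ~ bad_split.
Proof.
move=> [u [S' [k' [c [uT uC bar' Xc qS']]]]].
set M := T :\: _ in Xc.
have [MT' _] := barrier_dichotomy bar uT bar'; rewrite -/T -/M in MT'.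
set T' := _ :\: S' in MT'.
have [W' [WT' kI Wsmall Wq]] := small_transversal k' T' C.
have Tle : #|T'| <= 5 * n + E by rewrite -cardV; apply: max_card.
have qw := few_large_components EC nE Tle Wq.
have := barrier_card bar; have := barrier_classes bar.
have := barrier_card bar'; have := barrier_classes bar'; have := barrier_size bar'.
rewrite -/T -/T' => s'n stq' std' stq std; have dE := max_nbhd.
(* All of [M] lies in the component [c] of [T], so it is joined to [Kv] in colour [~~ b]. *)
have [Kv [KvN Kvcl Kvc qKv]] := barrier_clique bar c; rewrite -/T in Kvc qKv.
have dd' := min_nbhd (~~ b) u.
have tm : #|T| <= #|M| + C + #|S'|.
  rewrite -(cardsID (component T k u :|: S') T) addnC -addnA leq_add2l.
  apply: leq_trans (subset_leq_card (subsetIr _ _)) _.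
  by apply: leq_trans (leq_card_setU _ _) _; rewrite leq_add2r.
have mt' := subset_leq_card MT'.
pose W := W' :&: M.
have ww' : #|W'| + #|M| <= #|W| + #|T'|.
  rewrite /W -cardsUI addnC leq_add2l; apply: subset_leq_card.
  by rewrite subUset WT' MT'.
have qkv : #|k @: T| <= #|Kv| + 1 by rewrite addn1.
have WM : W \subset M by apply: subsetIr.
have choices := arith_choices n0 C2 CE dE std stq qS' s'n dd' std' stq' qw tm mt' ww' qkv.
have room := arith_room n0 C2 CE dE std stq qS' s'n dd' std' stq' qw tm mt' ww' qkv.
have gadgets p : p \in W -> False \/ exists F K : {set V},
    [/\ gadget col (~~ b) M p F K,
       n * #|F| <= 2 * (#|nbhd b v| + 2 * C - (2 * n + E + 1)) * (#|K|./2) &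
       #|F| <= #|nbhd b v| + 2 * C + #|S'| - (3 * n + E)].
  rewrite in_setI => /andP[pW' pM].
  have pT' := subsetP WT' p pW'.
  have [S'' [k'' [bar'' []]]] := gadget_or col_sym ff bar' pT' (Wsmall p pW') MT'; last first.
    case=> _ q's''; left.
    exact: (arith_no_split n0 C2 CE dE std stq qS' s'n dd' std' stq' qw tm mt' ww' qkv
      (barrier_size bar'') q's'').
  move=> [F [K [gad FS St dK]]]; right; exists F, K.
  have [? ?] := arith_gadget n0 C2 CE dE std stq qS' s'n dd' std' stq' qw tm mt' ww' qkv
    FS St (min_nbhd _ _) dK.
  by split.
have [[]|[t [f [tM fM fE fW fn]]]] := greedy col_sym n0 WM gadgets choices room.
have Msub x : x \in M -> x \in T by rewrite in_setD => /andP[].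
have [g gM gK] := clique_matching (edge_sym col_sym (~~ b)) Kvcl.
have gsub : covered g \subset Kv.
  by apply/subsetP => y; rewrite inE => /(matchingP _ _ _ gM).2[].
have gM' : matching (edge (~~ b)) [set: V] g by apply: matching_sub gM; apply: subsetT.
have gE x y : x \in M -> y \in covered g -> edge (~~ b) x y.
  by move=> xM /(subsetP gsub) yK; apply: Kvc => //; [apply: Msub | apply: Xc].
(* Each vertex of [f] is joined in colour [b] to some vertex of [M], those of [g] to none. *)
have dis : [disjoint covered f & covered g].
  apply/pred0P => y /=; apply/negP => /andP[/fW[p pW pE] yg].
  by apply: edgeN pE; apply: gE => //; apply: (subsetP WM).
have [h hM hc] := matching_union fM gM' dis.
have hN : covered h \subset nbhd (~~ b) t.
  apply/subsetP => y; rewrite hc !in_setU => /orP[/fE|/(gE _ _ tM)] ?; by rewrite inE.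
have := ff (matching_on hM hN); rewrite hc cardsU disjoint_setI0 // cards0 subn0.
move: fn gK; move: #|_| #|_| #|_| => x y z; clear; lia.
Qed.

End MaximumDegree.

Lemma fan_free_bound (V : finType) (col : rel V) (n E : nat) : symmetric col ->
  0 < n -> 6 <= E -> 30 * n + 5 * E <= E * E -> #|V| = 5 * n + E ->
  ~ fan_free col n.
Proof.
move=> col_sym n0 E6 nE cardV ff.
have [x0 _] : exists x, x \in V by apply/card_gt0P; rewrite cardV; lia.
case: (@arg_maxnP _ (true, x0) xpredT (fun p => #|nbhd col p.1 p.2|) isT) => -[b v] _ /= vmax.
have [S [k bar]] := barrier_ex col_sym b v ff.
have C2 : 2 <= E %/ 3 by lia.
have CE : 3 * (E %/ 3) <= E by lia.
have EC : E < 3 * (E %/ 3).+1 by lia.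
apply: (bad_splitN col_sym n0 C2 CE EC nE cardV ff bar); first by move=> c p; apply: (vmax (c, p)).
by apply: (bad_split_ex col_sym n0 C2 CE EC nE cardV ff bar) => c p; apply: (vmax (c, p)).
Qed.

Lemma mono_fan_of_matching n N (c : colouring N) b v f :
  let col x y := c [set x; y] in
  matching (edge col b) (nbhd col b v) f -> n.*2 <= #|covered f| ->
  mono_copy (fan n) c.
Proof.
move=> col fM; have [fK fE] := matchingP _ _ _ fM.
rewrite even_covered // leq_double; set A := [set x | _] => nA.
(* The [i]-th edge has the ends [a i], of smaller rank, and [f (a i)]. *)
pose a (i : 'I_n) := enum_val (widen_ord nA i).
have aA i : enum_rank (a i) < enum_rank (f (a i)).
  by have := enum_valP (widen_ord nA i); rewrite inE.
have aI : injective a by move=> i j /enum_val_inj /(congr1 val) /= /val_inj.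
have fa i : f (a i) != a i by apply: contraTneq (aA i) => ->; rewrite ltnn.
have afa i j : a i = f (a j) -> False.
  move=> aij; have := aA i; rewrite aij fK; have := aA j; lia.
pose g (x : fan n) := match x with
  | None => v | Some (i, s) => if s then f (a i) else a i end.
have vg i s : edge col b v (g (Some (i, s))).
  case: s => /=; last by have [] := fE _ (fa i); rewrite inE.
  by have [] := fE (f (a i)); rewrite ?inE // fK eq_sym.
have gI : injective g.
  move=> [[i s]|] [[j t]|] //=; first last.
  - by move=> vj; have := vg j t; rewrite /= -vj /edge eqxx.
  - by move=> vi; have := vg i s; rewrite /= vi /edge eqxx.
  by case: s t => [] [] => [/(inv_inj fK)/aI->|/esym/afa|/afa|/aI->].
apply/existsP; exists b; apply/existsP; exists (finfun g); apply/andP; split.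
  by apply/injectiveP => x y; rewrite !ffunE => /gI.
apply/forallP => x; apply/forallP => y; apply/implyP; rewrite !ffunE.
case: x y => [[i s]|] [[j t]|] //= => [/andP[/eqP<- st]|_|_].
- have [_] := fE _ (fa i); case/andP=> _.
  by move: st; case: s t => [] [] //= _; rewrite /col // setUC.
- by have /andP[_] := vg i s; rewrite /= /col setUC.
by have /andP[_] := vg j t.
Qed.

Lemma arrows_fan n E : 0 < n -> 6 <= E -> 30 * n + 5 * E <= E * E ->
  arrows (fan n) (5 * n + E).
Proof.
move=> n0 E6 nE; apply/forallP => c; apply: contraT => cN; exfalso.
have col_sym : symmetric (fun x y => c [set x; y]) by move=> x y; rewrite setUC.
apply: (fan_free_bound col_sym n0 E6 nE (card_ord _)) => b v f fM.
by rewrite ltnNge; apply: contra cN; apply: mono_fan_of_matching fM.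
Qed.

(** * Lower bound *)

(** Such a vertex cover excludes [n] independent edges inside [X]. *)
Definition small_cover (V : finType) (e : rel V) (X : {set V}) n :=
  exists2 C : {set V}, #|C| < n & {in X &, forall x y, e x y -> (x \in C) || (y \in C)}.

Lemma not_arrows_fan (V : finType) (col : rel V) n N : symmetric col -> N <= #|V| ->
  (forall b v, #|nbhd col b v| < n.*2 \/ small_cover (edge col b) (nbhd col b v) n) ->
  ~~ arrows (fan n) N.
Proof.
move=> col_sym NV hcol.
pose phi (x : 'I_N) : V := @enum_val _ V (widen_ord NV x).
have phiI : injective phi by move=> x y /enum_val_inj /(congr1 val) /= /val_inj.
pose c : colouring N := [ffun A => [exists x, exists y,
  [&& x != y, A == [set x; y] & col (phi x) (phi y)]]].
have cE x y : x != y -> c [set x; y] = col (phi x) (phi y).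
  move=> xy; rewrite ffunE; apply/idP/idP; last first.
    by move=> h; apply/existsP; exists x; apply/existsP; exists y; rewrite xy eqxx.
  move=> /existsP[x' /existsP[y' /and3P[xy' /eqP/setP eqA h]]].
  have := eqA x; have := eqA y; rewrite !inE !eqxx orbT /= => /esym yE /esym xE.
  case/orP: xE yE xy => /eqP xE; case/orP=> /eqP yE; rewrite xE yE ?eqxx // => _.
  by rewrite col_sym.
apply/negP => /forallP/(_ c)/existsP[b /existsP[g /andP[/injectiveP gI /forallP gE]]].
have edgeE x y : fan_adj x y -> edge col b (phi (g x)) (phi (g y)).
  move=> xy; have := gE x => /forallP/(_ y)/implyP/(_ xy) /eqP gc.
  have gxy : g x != g y.
    by rewrite (inj_eq gI); apply: contraTneq xy => ->; rewrite fan_adj_irrefl.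
  by rewrite /edge (inj_eq phiI) gxy -cE // gc eqxx.
pose v := phi (g None); pose a i s := phi (g (Some (i, s))).
have aI i s j t : a i s = a j t -> (i, s) = (j, t) by move/phiI/gI => [-> ->].
have aN i s : a i s \in nbhd col b v by rewrite inE; apply: edgeE.
have [small|[C Cn Ccov]] := hcol b v.
  have : #|[set a p.1 p.2 | p in [set: 'I_n * bool]]| <= #|nbhd col b v|.
    by apply/subset_leq_card/subsetP => _ /imsetP[p _ ->].
  rewrite card_imset; last by move=> [i s] [j t] /= /aI.
  by rewrite cardsT card_prod card_ord card_bool muln2 leqNgt small.
have cov i : (a i false \in C) || (a i true \in C).
  by apply: Ccov => //; apply: edgeE; rewrite /= eqxx.
(* An end of the [i]-th matching edge that lies in [C]. *)
pose r i := a i (a i false \notin C).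
have rC i : r i \in C by have := cov i; rewrite /r; case: (boolP (a i false \in C)).
have : #|[set r i | i in [set: 'I_n]]| <= #|C|.
  by apply/subset_leq_card/subsetP => _ /imsetP[i _ ->].
rewrite card_imset; last by move=> i j /aI[].
by rewrite cardsT card_ord leqNgt Cn.
Qed.

(** * Nearly biregular bipartite graphs *)

Section BalancedBipartite.
Variables (l k d : nat).
Hypothesis dk : d <= k.

(* The number of m < j d with m = t modulo k, so that consecutive values of j
   cut the cycle of length k into consecutive arcs of length d. *)
Definition arc_count (j t : nat) := (j * d + (k - t.+1)) %/ k.

(** True when the [i]-th arc contains [t]; as [d <= k], it does so at most once. *)
Definition balanced (i : 'I_l) (t : 'I_k) := arc_count i.+1 t != arc_count i t.

Lemma arc_countS i t : 0 < k -> arc_count i.+1 t =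
  arc_count i t + (arc_count i.+1 t != arc_count i t).
Proof.
rewrite /arc_count mulSn -addnA => k0; set m := i * d + _.
have h1 : m %/ k <= (d + m) %/ k by rewrite leq_div2r ?leq_addl.
have h2 : (d + m) %/ k <= (m %/ k).+1.
  have <- : (m + k) %/ k = (m %/ k).+1 by rewrite divnDr ?dvdnn // divnn k0 addn1.
  by rewrite leq_div2r // addnC leq_add2l.
by case: eqP h1 h2; lia.
Qed.

(** Hermite's identity: passing from [m] to [m.+1] replaces the term [m %/ k] by [(m + k) %/ k]. *)
Lemma hermite m : 0 < k -> \sum_(t < k) (m + t) %/ k = m.
Proof.
move=> k0; elim: m => [|m IHm].
  by rewrite big1 // => t _; rewrite divn_small // add0n.
have := big_ord_recl k (fun t => (m + t) %/ k) : \sum_(t < k.+1) _ = _.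
rewrite big_ord_recr /= IHm divnDr ?dvdnn // divnn k0 addn0 addn1 addnS -addSn.
move/eqP; rewrite addnC eqn_add2l => /eqP mE; rewrite [RHS]mE.
by apply: eq_bigr => t _; rewrite /bump /= add1n addnS.
Qed.

Lemma sum_arc_count j : 0 < k -> \sum_(t < k) arc_count j t = j * d.
Proof.
move=> k0; rewrite (reindex_inj rev_ord_inj) /= -[RHS]hermite //.
apply: eq_bigr => t _; rewrite /arc_count; congr ((_ + _) %/ _).
by have := ltn_ord t; lia.
Qed.

Lemma balanced_row i : #|[set t | balanced i t]| = d.
Proof.
have [k0|k0] := posnP k.
  have d0 : d = 0 by lia.
  rewrite d0; apply/eqP; rewrite cards_eq0; apply/eqP/setP => t.
  by exfalso; have := ltn_ord t; move: k0; clear; lia.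
have : \sum_(t < k) arc_count i.+1 t = \sum_(t < k) (arc_count i t + balanced i t).
  by apply: eq_bigr => t _; apply: arc_countS.
rewrite big_split /= !sum_arc_count // mulSn addnC => /addnI ->.
by rewrite -sum1dep_card big_mkcond; apply: eq_bigr => t _; case: balanced.
Qed.

Lemma balanced_col t : #|[set i | balanced i t]| = (l * d + (k - t.+1)) %/ k.
Proof.
have k0 : 0 < k by apply: leq_ltn_trans (ltn_ord t).
rewrite -[RHS]/(arc_count l t) -sum1dep_card big_mkcond /=.
have -> j : arc_count j t = \sum_(i < j) (arc_count i.+1 t != arc_count i t).
  elim: j => [|j IHj].
    by rewrite big_ord0 /arc_count mul0n add0n divn_small //; lia.
  by rewrite big_ord_recr /= -IHj -arc_countS.
by apply: eq_bigr => i _; rewrite /balanced; case: eqP.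
Qed.

End BalancedBipartite.

Section LowerConstruction.
Variables (n l k d : nat).
(** [ld] and [lk_ub] bound the red degrees in L and K; [kd] and [lk_lb] bound the covers of the blue
    neighbourhoods of their vertices. *)
Hypotheses (dk : d <= k) (ld : l + d <= n.*2) (kd : k.*2 < n + d).
Hypotheses (lk_lb : l * k + k <= l * d + n * k) (lk_ub : l * d + k.*2 * k <= n.*2 * k).

Let V := (bool * ('I_l + 'I_k))%type.

(* In the notation of the header, (s, inl i) lies in L_s and (s, inr t) in K_s;
   red is true. *)
Definition fan_col : rel V := fun u v => match u.2, v.2 with
  | inl _, inl _ => u.1 == v.1
  | inr _, inr _ => true
  | inl i, inr t | inr t, inl i => (u.1 == v.1) && balanced d i t
  end.

Lemma fan_col_sym : symmetric fan_col.
Proof. by move=> [s [i|t]] [s' [j|t']]; rewrite /fan_col //= eq_sym. Qed.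

Lemma balanced_row_lt (i : 'I_l) : #|[set~ i]| + #|[set t : 'I_k | balanced d i t]| < n.*2.
Proof.
by rewrite balanced_row // cardsC1 card_ord; have := ltn_ord i; move: ld; clear; lia.
Qed.

Lemma balanced_rowC (i : 'I_l) : k + #|[set t : 'I_k | ~~ balanced d i t]| < n.
Proof.
have := cardsC [set t : 'I_k | balanced d i t].
rewrite balanced_row // card_ord (_ : ~: _ = [set t | ~~ balanced d i t]).
  by move: #|[set t | ~~ _]| kd => x; clear; lia.
by apply/setP => t; rewrite !inE.
Qed.

Lemma balanced_col_le (t : 'I_k) : k.*2 + #|[set i : 'I_l | balanced d i t]| <= n.*2.
Proof.
have tk := ltn_ord t; have k0 := leq_ltn_trans (leq0n _) tk.
rewrite balanced_col //; set q := _ %/ k.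
have : q * k <= l * d + (k - t.+1) by apply: leq_trunc_div.
by move: lk_ub k0 tk; clear; nia.
Qed.

Lemma balanced_colC (t : 'I_k) : #|[set i : 'I_l | ~~ balanced d i t]| < n.
Proof.
have tk := ltn_ord t; have k0 := leq_ltn_trans (leq0n _) tk.
have := cardsC [set i : 'I_l | balanced d i t].
rewrite (_ : ~: _ = [set i | ~~ balanced d i t]); last by apply/setP => i; rewrite !inE.
rewrite balanced_col // card_ord; set q := _ %/ k => ql.
have : l * d < (q + 1) * k.
  by apply: leq_ltn_trans (leq_addr (k - t.+1) _) _; rewrite addn1 -ltn_divLR.
move=> ldq; have : l.+1 < q + 1 + n by rewrite -(ltn_pmul2r k0) mulSn; move: lk_lb ldq; clear; nia.
by move: ql; move: #|[set i | ~~ _]| => x; clear; lia.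
Qed.

Lemma fan_col_free b v : #|nbhd fan_col b v| < n.*2 \/
  small_cover (edge fan_col b) (nbhd fan_col b v) n.
Proof.
case: b v => [] [s [i|t]].
- left; apply: leq_ltn_trans (balanced_row_lt i).
  pose A := [set ((s, inl j) : V) | j in [set~ i]].
  pose B := [set ((s, inr t) : V) | t in [set t | balanced d i t]].
  apply: leq_trans (_ : #|A :|: B| <= _); last first.
    by apply: leq_trans (leq_card_setU _ _) _; apply: leq_add; apply: leq_imset_card.
  apply/subset_leq_card/subsetP => -[s' [j|t]]; rewrite !inE /edge /fan_col /=.
    move=> /andP[ij /eqP/eqP ss]; rewrite -ss in ij *; apply/orP; left.
    by apply/imsetP; exists j; rewrite // !inE; apply: contra ij => /eqP->.
  move=> /andP[_ /eqP/andP[/eqP<- it]]; apply/orP; right.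
  by apply/imsetP; exists t; rewrite // inE.
- left; rewrite -[n.*2](subnK (balanced_col_le t)).
  pose X := [set ((p.1, inr p.2) : V) | p in [set: bool * 'I_k]].
  pose A := X :\ (s, inr t).
  pose B := [set ((s, inl i) : V) | i in [set i | balanced d i t]].
  have cA : #|A| < k.*2.
    apply: leq_trans (_ : #|X| <= _).
      by rewrite [X in _ < X](cardsD1 (s, inr t)) (_ : _ \in X) // /X; apply/imsetP; exists (s, t).
    by apply: leq_trans (leq_imset_card _ _) _; rewrite cardsT card_prod card_bool card_ord mul2n.
  apply: leq_ltn_trans (_ : #|A :|: B| < _).
    apply/subset_leq_card/subsetP => -[s' [j|t']]; rewrite !inE /edge /fan_col /=.
      move=> /andP[_ /eqP/andP[/eqP<- it]]; apply/orP; right.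
      by apply/imsetP; exists j; rewrite // inE.
    move=> /andP[ij _]; apply/orP; left; rewrite eq_sym ij /=.
    by apply/imsetP; exists (s', t'); rewrite ?inE.
  apply: leq_ltn_trans (leq_card_setU _ _) _.
  apply: leq_trans (leq_addl _ _); rewrite -addSn; apply: leq_add => //.
  exact: leq_imset_card.
(* The blue neighbours in K form the cover; the others lie in the red clique L of the opposite
   side. *)
- right; pose A := [set ((~~ s, inr t) : V) | t in [set: 'I_k]].
  pose B := [set ((s, inr t) : V) | t in [set t : 'I_k | ~~ balanced d i t]].
  exists (A :|: B).
    apply: leq_ltn_trans (balanced_rowC i); apply: leq_trans (leq_card_setU _ _) _.
    by apply: leq_add; apply: leq_trans (leq_imset_card _ _) _; rewrite ?cardsT ?card_ord.
  have inAB s' t : (s', inr t) \in nbhd fan_col false (s, inl i) -> (s', inr t) \in A :|: B.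
    rewrite !inE /edge /fan_col /=; have [<-|ss'] := eqVneq s s' => /= h; apply/orP.
      by right; apply/imsetP; exists t; rewrite // inE; case: balanced h; rewrite ?andbF.
    left; apply/imsetP; exists t; rewrite ?inE //.
    by congr (_, _); case: s s' ss' {h A B} => [] [].
  move=> [s1 [j|t]] [s2 [j'|t']] h1 h2; first last.
  + by move=> _; rewrite (inAB _ _ h1).
  + by move=> _; rewrite (inAB _ _ h1).
  + by move=> _; rewrite (inAB _ _ h2) orbT.
  move=> h3; exfalso; move: h1 h2 h3; rewrite !inE /edge /fan_col /=.
  by clear; case: s s1 s2 => [] [] []; rewrite ?andbF.
(* All blue neighbours lie in L; those on the opposite side form a red clique, so those on side [s]
   are a cover. *)
- right; pose A := [set ((s, inl i) : V) | i in [set i : 'I_l | ~~ balanced d i t]].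
  exists A; first exact: leq_ltn_trans (leq_imset_card _ _) (balanced_colC t).
  have inA i : (s, inl i) \in nbhd fan_col false (s, inr t) -> (s, inl i) \in A.
    rewrite !inE /edge /fan_col /= eqxx /= => h; apply/imsetP; exists i => //.
    by rewrite inE; case: balanced h; rewrite ?andbF.
  move=> [s1 [j|t1]] [s2 [j'|t']] h1 h2; last 3 first.
  + by move: h2; rewrite inE /edge /fan_col /= andbF.
  + by move: h1; rewrite inE /edge /fan_col /= andbF.
  + by move: h1; rewrite inE /edge /fan_col /= andbF.
  have [e1|n1] := eqVneq s s1; first by move: h1; rewrite -e1 => /inA ->.
  have [e2|n2] := eqVneq s s2; first by move: h2; rewrite -e2 => /inA ->; rewrite orbT.
  move=> h3; exfalso; move: n1 n2 h3; rewrite /edge /fan_col /=.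
  by clear; case: s s1 s2 => [] [] []; rewrite ?andbF.
Qed.

Lemma not_arrows_construction N : N <= (l + k).*2 -> ~~ arrows (fan n) N.
Proof.
move=> Nle; apply: (not_arrows_fan fan_col_sym _ fan_col_free).
by rewrite card_prod card_bool card_sum !card_ord mul2n.
Qed.

End LowerConstruction.

(* The assumptions say that d is the integer part of (2 - sqrt 3) n. *)
Lemma construction_parameters n d : 13 <= n -> d < n ->
  4 * n * d <= n * n + d * d -> n * n + d.+1 * d.+1 < 4 * n * d.+1 ->
  let l := 2 * n - d in let k := (l * d) %/ (n - d).+1 in
  [/\ d <= k, l + d <= n.*2, k.*2 < n + d,
      l * k + k <= l * d + n * k & l * d + k.*2 * k <= n.*2 * k].
Proof.
move=> n13 dn dlo dhi l k.
have d3 : 3 <= d by nia.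
have d_n : 3 * d <= n by nia.
have Dl : (n - d).+1 <= l by rewrite /l; lia.
(* For [l = 2 * n - d] this is the fourth conclusion, and [k] is the largest value satisfying it. *)
have kD : k * (n - d).+1 <= l * d by apply: leq_trunc_div.
have kD' : l * d < k.+1 * (n - d).+1 by rewrite -ltn_divLR.
have ln : l + d = 2 * n by rewrite /l; lia.
have dk : d <= k by rewrite /k leq_divRL // mulnC leq_mul2r Dl orbT.
clearbody l k.
have ne : exists e, n = e + d by exists (n - d); lia.
case: ne => e ne; subst n; have le : l = 2 * e + d by lia.
rewrite addnK in Dl kD kD' *; subst l.
have ke : k.*2 + 2 <= e + d + d by nia.
have ek : e <= k.*2.
  have [d4|d4] := leqP 4 d; first nia.
  have {}d3 : d = 3 by lia.
  subst d; have e11 : e <= 11 by nia.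
  by nia.
split=> //; [lia | lia | nia | ].
by nia.
Qed.

(** * The bounds as real inequalities *)

Lemma arrows_ramsey (H : sgraph) : arrows H (ramsey_number H).
Proof. by rewrite /ramsey_number; case: ex_minnP. Qed.

Lemma ramsey_le (H : sgraph) N : arrows H N -> ramsey_number H <= N.
Proof. by rewrite /ramsey_number; case: ex_minnP => m _; apply. Qed.

Import Order.TTheory GRing.Theory Num.Theory.
Local Open Scope ring_scope.

(** With 9 in place of 8, an integer [N <= (3 + r) * n - 8] satisfies [N < 2 * (l + k) + 1], hence
    [N <= 2 * (l + k)]. *)
Lemma lower_size (R : realFieldType) (r n d e l k : R) : 0 <= r -> r ^+ 2 = 3 ->
  13 <= n -> d <= (2 - r) * n -> (2 - r) * n < d + 1 -> 0 < e -> e = n - d + 1 -> l = 2 * n - d ->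
  l * d < (k + 1) * e -> (3 + r) * n - 9 < 2 * (l + k).
Proof.
move=> r0 r2 n13 dlo dhi e0 eE lE kD; rewrite ltNge; apply/negP => kle.
have r17 : 17/10 < r by nra.
pose t := (2 - r) * n - d.
have dE : d = (2 - r) * n - t by rewrite /t; ring.
have t0 : 0 <= t by rewrite /t; lra.
have t1 : t < 1 by rewrite /t; lra.
have k2 : 2 * (k + 1) <= (r - 1) * n - 7 + 2 * d by lra.
have prod : 2 * (l * d) < ((r - 1) * n - 7 + 2 * d) * e.
  apply: lt_le_trans (_ : 2 * ((k + 1) * e) <= _); first by lra.
  by rewrite mulrA ler_pM2r.
(* The quadratic terms in [n] cancel. As [t < 1], the coefficient of [n] exceeds
   [7 * r - 11 > 0]. *)
have gap : 2 * (l * d) - ((r - 1) * n - 7 + 2 * d) * e =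
    n * (8 * r - 10 - t * (1 + r)) + 7 + 9 * t.
  rewrite lE eE dE; ring: r2.
have : 0 < 8 * r - 10 - t * (1 + r) by nra.
have : 0 < n by lra.
move=> n0 c0; have := mulr_gt0 n0 c0; lra.
Qed.

Lemma ramsey_lower (R : realType) (n : nat) : (0 < n)%N ->
  (3 + Num.sqrt 3) * n%:R - 8 < (ramsey_number (fan n))%:R :> R.
Proof.
move=> n0; have arr := arrows_ramsey (fan n); move: arr; set N := ramsey_number _ => arr.
rewrite ltNge; apply/negP => Nle.
set r : R := Num.sqrt 3 in Nle.
have r0 : 0 <= r by apply: sqrtr_ge0.
have r2 : r ^+ 2 = 3 by rewrite sqr_sqrtr.
have r_lt : r < 174/100 by nra.
have r_gt : 17/10 < r by nra.
(* For small [n], two disjoint red cliques on [2 * n] vertices each suffice. *)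
have [n12|n13] := leqP n 12.
  suff NN : (N <= (2 * n + 0).*2)%N.
    have : ~~ arrows (fan n) N.
      by apply: (@not_arrows_construction n (2 * n) 0 0) => //; clear -n0; lia.
    by rewrite arr.
  have nR : n%:R <= 12 :> R by rewrite ler_nat.
  have nR0 : 0 <= n%:R :> R by [].
  have : N%:R < (4 * n + 1)%:R :> R by rewrite natrD natrM; nra.
  by rewrite ltr_nat; lia.
have nR : 13 <= n%:R :> R by rewrite ler_nat.
have x0 : 0 <= (2 - r) * n%:R by nra.
have /andP[dlo dhi] := Num.Theory.truncn_itv x0.
set d := Num.truncn _ in dlo dhi; rewrite -[d.+1%:R]natr1 in dhi.
have d0 : 0 <= d%:R :> R by [].
have dn : (d < n)%N by rewrite -(ltr_nat R); nra.
(* The roots of [x^2 - 4 n x + n^2] are [(2 - r) * n] and [(2 + r) * n]: [d] is at most both, and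
   [d + 1] is strictly between them. *)
have lo : (4 * n * d <= n * n + d * d)%N.
  rewrite -(ler_nat R) natrD !natrM.
  have h : 0 <= ((2 - r) * n%:R - d%:R) * ((2 + r) * n%:R - d%:R) by apply: mulr_ge0; nra.
  by nra.
have hi : (n * n + d.+1 * d.+1 < 4 * n * d.+1)%N.
  rewrite -(ltr_nat R) natrD !natrM -natr1.
  have h : 0 < (d%:R + 1 - (2 - r) * n%:R) * ((2 + r) * n%:R - (d%:R + 1)).
    by apply: mulr_gt0; nra.
  by nra.
have [dk ld kd lk_lb lk_ub] := construction_parameters n13 dn lo hi.
move: dk ld kd lk_lb lk_ub; set l := (2 * n - d)%N; set k := (_ %/ _)%N => dk ld kd lk_lb lk_ub.
have lR : l%:R = 2 * n%:R - d%:R :> R by rewrite natrB ?natrM // (leq_trans (ltnW dn)) ?leq_pmull.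
have eR : (n - d).+1%:R = n%:R - d%:R + 1 :> R by rewrite -natr1 natrB // ltnW.
have kD : (l * d)%:R < (k.+1 * (n - d).+1)%:R :> R by rewrite ltr_nat -ltn_divLR.
rewrite !natrM -natr1 in kD.
have e0 : 0 < (n - d).+1%:R :> R by rewrite ltr0n.
have size := lower_size r0 r2 nR dlo dhi e0 eR lR kD.
have : N%:R < ((l + k).*2 + 1)%:R :> R.
  by rewrite natrD -mul2n natrM natrD; lra.
rewrite ltr_nat addn1 ltnS => Nlk.
by have := not_arrows_construction dk ld kd lk_lb lk_ub Nlk; rewrite arr.
Qed.

Lemma ramsey_upper (R : realType) (eps : R) (n : nat) : 0 < eps -> (0 < n)%N ->
  384 / eps ^+ 2 <= n%:R -> (ramsey_number (fan n))%:R <= (5 + eps) * n%:R :> R.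
Proof.
move=> eps0 n0 n_large; have n0R : 0 < n%:R :> R by rewrite ltr0n.
have x0 : 0 <= eps * n%:R by apply: mulr_ge0; lra.
have /andP[Elo Ehi] := Num.Theory.truncn_itv x0.
set E := Num.truncn _ in Elo Ehi.
(* [n_large] says that [(eps * n)^2 >= 384 * n], and [E] is [eps * n] rounded down. *)
have big : (384 * n < E.+1 * E.+1)%N.
  rewrite -(ltr_nat R) !natrM.
  apply: (@le_lt_trans _ _ ((eps * n%:R) * (eps * n%:R))); last by apply: ltr_pM.
  rewrite ler_pdivrMr ?exprn_gt0 // in n_large; nra.
have E6 : (6 <= E)%N by nia.
have nE : (30 * n + 5 * E <= E * E)%N by nia.
have := ramsey_le (arrows_fan n0 E6 nE); rewrite -(ler_nat R) natrD natrM.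
by move=> h; lra.
Qed.

Theorem theorem1p1 (R : realType) (eps : R) (n : nat)
  (eps_gt0 : 0 < eps) (n_gt0 : (0 < n)%N)
  (n_large : n%:R >= 384 / eps ^+ 2) :
  (3 + Num.sqrt 3) * n%:R - 8 < (ramsey_number (fan n))%:R :> R /\
  (ramsey_number (fan n))%:R <= (5 + eps) * n%:R :> R.
Proof. by split; [apply: ramsey_lower | apply: ramsey_upper]. Qed.
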